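(* Suppose $(P,\leq_P)$ is a locally countable Borel partial order of size continuum, $Q$ is an uncountable, countably directed Borel subset of $P$, and $x$ is an element of $P$ which is not below any element of $Q$. Then $P$ has no Borel embedding into Turing reducibility.
   Context: A Borel partial order is a partial order $(P,\leq_P)$ with $P$ a Borel subset of $2^\omega$ and $\leq_P$ a Borel subset of $2^\omega\times 2^\omega$; it is locally countable if every element has at most countably many strict predecessors. A subset $Q\subseteq P$ is countably directed if every countable subset of $Q$ has an upper bound in $Q$. A Borel embedding of $P$ into Turing reducibility is a Borel function $f\colon P\to 2^\omega$ with $a\leq_P b\iff f(a)\leq_T f(b)$ for all $a,b\in P$. *)

(* Defs.v *)
From HB Require Import structures.
From mathcomp Require Import all_boot all_order all_algebra.
From mathcomp Require Import all_classical all_reals.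
From mathcomp Require Import topology measure cantor.
From Stdlib Require Import List.

Set Implicit Arguments.
Unset Strict Implicit.
Unset Printing Implicit Defensive.

Local Open Scope classical_set_scope.

Definition Borel (T : topologicalType) (A : set T) : Prop := <<s open >> A.

(* Codes of partial mu-recursive functions relative to an oracle. *)
Inductive code : Type :=
| CZero : code
| CSucc : code
| CProj : nat -> code
| COracle : code
| CComp : code -> list code -> code
| CPrim : code -> code -> code
| CMu : code -> code.

Definition b2n (b : bool) : nat := if b then 1%N else 0%N.

Inductive eval (o : nat -> bool) : code -> list nat -> nat -> Prop :=
| ev_zero xs : eval o CZero xs 0
| ev_succ x xs : eval o CSucc (x :: xs) (S x)
| ev_proj i xs : (i < length xs)%coq_nat -> eval o (CProj i) xs (nth i xs 0%N)
| ev_oracle x xs : eval o COracle (x :: xs) (b2n (o x))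
| ev_comp f gs xs ys y :
    evals o gs xs ys -> eval o f ys y -> eval o (CComp f gs) xs y
| ev_prim0 f g xs y : eval o f xs y -> eval o (CPrim f g) (0 :: xs) y
| ev_primS f g n xs r y :
    eval o (CPrim f g) (n :: xs) r -> eval o g (n :: r :: xs) y ->
    eval o (CPrim f g) (S n :: xs) y
| ev_mu f xs n :
    eval o f (n :: xs) 0 ->
    (forall m, (m < n)%coq_nat -> exists k, eval o f (m :: xs) (S k)) ->
    eval o (CMu f) xs n
with evals (o : nat -> bool) : list code -> list nat -> list nat -> Prop :=
| evs_nil xs : evals o nil xs nil
| evs_cons g gs xs y ys :
    eval o g xs y -> evals o gs xs ys -> evals o (g :: gs) xs (y :: ys).

Definition turing_le (a b : nat -> bool) : Prop :=
  exists c : code, forall n : nat, eval b c (n :: nil) (b2n (a n)).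

Notation cs := cantor_space.

Definition is_partial_order_on (P : set cs) (le : set (cs * cs)) : Prop :=
  (forall a b, le (a, b) -> P a /\ P b) /\
  (forall a, P a -> le (a, a)) /\
  (forall a b, P a -> P b -> le (a, b) -> le (b, a) -> a = b) /\
  (forall a b c, P a -> P b -> P c -> le (a, b) -> le (b, c) -> le (a, c)).

Definition Borel_partial_order (P : set cs) (le : set (cs * cs)) : Prop :=
  Borel P /\ Borel le /\ is_partial_order_on P le.

Definition locally_countable (P : set cs) (le : set (cs * cs)) : Prop :=
  forall b, P b -> countable [set a | P a /\ le (a, b) /\ a <> b].

Definition countably_directed (le : set (cs * cs)) (Q : set cs) : Prop :=
  forall C : set cs, C `<=` Q -> countable C ->
    exists u, Q u /\ forall c, C c -> le (c, u).

(* Borel function P -> 2^omega (f is total on cs; only its values on P matter) *)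
Definition Borel_function_on (P : set cs) (f : cs -> cs) : Prop :=
  forall B : set cs, Borel B -> Borel (P `&` f @^-1` B).

Definition Borel_embedding_into_Turing (P : set cs) (le : set (cs * cs))
  (f : cs -> cs) : Prop :=
  Borel_function_on P f /\
  forall a b, P a -> P b -> (le (a, b) <-> turing_le (f a) (f b)).

(* Main.v *)
From mathcomp Require Import all_boot all_classical topology measure cantor zify.
Require Import Defs.

(** If [f] embedded [P], then [A := f(Q)] would be an uncountable analytic set,
countably directed under Turing reducibility, and we show that [A] is cofinal,
so that [f x] is below some [f q], a contradiction.

Take the condensation points of a closed set projecting onto [A] and a
countable set [B] of elements of [A] that branches everywhere inside it, and let
[c] in [A] compute every element of [B], not necessarily uniformly.
Given a real [x], four elements of [A], grouped in two pairs, are built as limits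
of elements of [B]. The two pairs take turns: at stage [k] both members of a pair
leave their current targets in [B] and move to new ones, in an order that codes
the bit [x k]. The smaller of the two departure places is chosen above indices,
relative to [c], of the current targets of the other pair, and the larger one so
large that every wrong index below the smaller one errs before it. Hence from [c],
the four reals and the last two departure places one can find, by search, correct
indices for the targets of the other pair, and so its next two departure places.
An upper bound in [A] of [c] and the four reals therefore computes [x]. *)

Set Implicit Arguments.
Unset Strict Implicit.
Unset Printing Implicit Defensive.

Local Open Scope classical_set_scope.

(** * Pairing of natural numbers *)

Lemma nsqrt_subproof n : exists s, (n < s.+1 * s.+1)%N.
Proof. by exists n; nia. Qed.

Definition nsqrt n := ex_minn (nsqrt_subproof n).

(** Since [a <= a + b], the value lies between the squares of [a + b] and of its successor, so the
    integer square root recovers [a + b]. The pairing is injective but not onto. *)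
Definition npair a b := ((a + b) * (a + b) + a)%N.
Definition nfst n := (n - nsqrt n * nsqrt n)%N.
Definition nsnd n := (nsqrt n - nfst n)%N.

Lemma nsqrt_npair a b : nsqrt (npair a b) = (a + b)%N.
Proof.
rewrite /nsqrt /npair; case: ex_minnP => s h1 h2.
have h3 := h2 (a + b)%N; have : (s <= a + b)%N by apply: h3; nia.
by rewrite leq_eqVlt => /orP[/eqP//|]; nia.
Qed.

Lemma npairK1 a b : nfst (npair a b) = a.
Proof. by rewrite /nfst nsqrt_npair /npair; lia. Qed.

Lemma npairK2 a b : nsnd (npair a b) = b.
Proof. by rewrite /nsnd npairK1 nsqrt_npair; lia. Qed.

Definition npairE := (npairK1, npairK2).

(** * Functions computable relative to an oracle *)

Section Computable.
Variable u : nat -> bool.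

Definition computable (F : nat -> nat) : Prop :=
  exists c, forall n, eval u c [:: n] (F n).

Definition computable2 (F : nat -> nat -> nat) : Prop :=
  exists c, forall m n, eval u c [:: m; n] (F m n).

Lemma eval_proj i xs y :
  List.nth_error xs i = Some y -> eval u (CProj i) xs y.
Proof.
move=> e; have <- : List.nth i xs 0%N = y by exact: List.nth_error_nth e.
by apply: ev_proj; apply/List.nth_error_Some; rewrite e.
Qed.

Ltac proj := exact: eval_proj.
Ltac evals := repeat first [apply: evs_nil | apply: evs_cons].

Lemma computable2_add : computable2 addn.
Proof.
exists (CPrim (CProj 0) (CComp CSucc [:: CProj 1])) => m n.
elim: m => [|m IH]; first by apply: ev_prim0; proj.
apply: (ev_primS IH); apply: ev_comp; first by evals; proj.
exact: ev_succ.
Qed.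

Lemma computable2_comp F G H : computable2 F -> computable2 G -> computable2 H ->
  computable2 (fun m n => F (G m n) (H m n)).
Proof.
move=> [f hf] [g hg] [h hh]; exists (CComp f [:: g; h]) => m n.
by apply: ev_comp; first by [apply: evs_cons (hg m n) (evs_cons (hh m n) (evs_nil _ _))].
Qed.

Lemma computable2_fst : computable2 (fun m _ => m).
Proof. by exists (CProj 0) => m n; proj. Qed.

Lemma computable2_snd : computable2 (fun _ n => n).
Proof. by exists (CProj 1) => m n; proj. Qed.

Lemma computable2_mul : computable2 muln.
Proof.
have [a ha] := computable2_add.
exists (CPrim CZero (CComp a [:: CProj 2; CProj 1])) => m n.
elim: m => [|m IH]; first by apply: ev_prim0; constructor.
rewrite mulSn; apply: (ev_primS IH); apply: ev_comp (ha _ _).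
by evals; proj.
Qed.

Lemma computable2_sub : computable2 subn.
Proof.
pose p := CPrim CZero (CProj 0).
have hp n : eval u p [:: n] n.-1.
  elim: n => [|n IH]; first by apply: ev_prim0; constructor.
  by apply: (ev_primS IH); proj.
exists (CComp (CPrim (CProj 0) (CComp p [:: CProj 1])) [:: CProj 1; CProj 0]) => m n.
apply: (@ev_comp _ _ _ _ [:: n; m]); first by evals; proj.
elim: n => [|n IH]; first by rewrite subn0; apply: ev_prim0; proj.
rewrite subnS; apply: (ev_primS IH); apply: ev_comp (hp _).
by evals; proj.
Qed.

Lemma computable2_npair : computable2 npair.
Proof.
have h := computable2_add.
exact: (computable2_comp h (computable2_comp computable2_mul h h) computable2_fst).
Qed.

Lemma computable_comp F G : computable F -> computable G ->
  computable (fun n => F (G n)).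
Proof.
move=> [f hf] [g hg]; exists (CComp f [:: g]) => n.
by apply: ev_comp (hf _); apply: evs_cons (hg n) (evs_nil _ _).
Qed.

Lemma computable_comp2 F G H : computable2 F -> computable G -> computable H ->
  computable (fun n => F (G n) (H n)).
Proof.
move=> [f hf] [g hg] [h hh]; exists (CComp f [:: g; h]) => n.
apply: ev_comp (hf _ _).
exact: evs_cons (hg n) (evs_cons (hh n) (evs_nil _ _)).
Qed.

Lemma computable_id : computable (fun n => n).
Proof. by exists (CProj 0) => n; proj. Qed.

Lemma computable_succ F : computable F -> computable (fun n => (F n).+1).
Proof.
by apply: computable_comp; exists CSucc => n; constructor.
Qed.

Lemma computable_const k : computable (fun=> k).
Proof.
elim: k => [|k]; first by exists CZero => n; constructor.
exact: computable_succ.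
Qed.

Lemma computable_npair F G : computable F -> computable G ->
  computable (fun n => npair (F n) (G n)).
Proof. exact: computable_comp2 computable2_npair. Qed.

Lemma computable_add F G : computable F -> computable G ->
  computable (fun n => F n + G n)%N.
Proof. exact: computable_comp2 computable2_add. Qed.

Lemma computable_sub F G : computable F -> computable G ->
  computable (fun n => F n - G n)%N.
Proof. exact: computable_comp2 computable2_sub. Qed.

Lemma computable_mul F G : computable F -> computable G ->
  computable (fun n => F n * G n)%N.
Proof. exact: computable_comp2 computable2_mul. Qed.

Lemma computable_mu F G : computable2 F ->
  (forall n, F (G n) n = 0%N /\ forall m, (m < G n)%N -> F m n <> 0%N) ->
  computable G.
Proof.
move=> [f hf] hG; exists (CMu f) => n; have [h0 hlt] := hG n.
apply: ev_mu => [|m /ssrnat.ltP/hlt]; first by rewrite -[in X in eval _ _ _ X]h0.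
by case e: (F m n) => [//|k] _; exists k; rewrite -e.
Qed.

Lemma computable2_comp1 F G : computable F -> computable2 G ->
  computable2 (fun m n => F (G m n)).
Proof.
move=> [f hf] [g hg]; exists (CComp f [:: g]) => m n.
by apply: ev_comp (hf _); apply: evs_cons (hg m n) (evs_nil _ _).
Qed.

Lemma computable_nsqrt : computable nsqrt.
Proof.
have S G : computable2 G -> computable2 (fun m n => (G m n).+1).
  exact: (computable2_comp1 (computable_succ computable_id)).
have [m n] := (computable2_fst, computable2_snd).
(* By truncation this difference vanishes exactly when [s] is at least the integer square root of
   [n]. *)
have t : computable2 (fun s n => n.+1 - s.+1 * s.+1)%N.
  apply: (computable2_comp computable2_sub); first exact: S.
  by apply: (computable2_comp computable2_mul); apply: S.
apply: (computable_mu t) => {}n; rewrite /nsqrt.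
case: ex_minnP => s h1 h2; split; first by nia.
move=> {}m hm e; have := h2 m; nia.
Qed.

Lemma computable_nfst F : computable F -> computable (fun n => nfst (F n)).
Proof.
apply: computable_comp; have h := computable_nsqrt.
exact: computable_sub computable_id (computable_mul h h).
Qed.

Lemma computable_nsnd F : computable F -> computable (fun n => nsnd (F n)).
Proof.
apply: computable_comp.
exact: computable_sub computable_nsqrt (computable_nfst computable_id).
Qed.

(* The step function receives the counter, the accumulator and the context
   packed into one number. *)
Lemma computable_iteri F G S : computable F -> computable G ->
  computable (fun v => S (nsnd (nsnd v)) (nfst v) (nfst (nsnd v))) ->
  computable (fun x => iteri (F x) (S x) (G x)).
Proof.
move=> [f hf] [g hg] [s hs]; have [p hp] := computable2_npair.
pose s' := CComp s [:: CComp p [:: CProj 0; CComp p [:: CProj 1; CProj 2]]].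
exists (CComp (CPrim g s') [:: f; CProj 0]) => x.
apply: (@ev_comp _ _ _ _ [:: F x; x]).
  by apply: evs_cons (hf x) _; evals; proj.
elim: (F x) => [|n IH]; first exact: ev_prim0.
apply: (ev_primS IH); apply: ev_comp; last first.
  by have := hs (npair n (npair (iteri n (S x) (G x)) x)); rewrite !npairE; apply.
evals; apply: ev_comp (hp _ _); evals; first by proj.
by apply: ev_comp (hp _ _); evals; proj.
Qed.

Lemma computable_iter F G S : computable F -> computable G ->
  computable (fun v => S (nsnd v) (nfst v)) ->
  computable (fun x => iter (F x) (S x) (G x)).
Proof.
move=> hF hG hS.
rewrite (_ : (fun x => _) = fun x => iteri (F x) (fun=> S x) (G x)); last first.
  by apply/funext => x; elim: (F x) => //= n ->.
apply: (computable_iteri (S := fun x _ => S x)) => //.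
have := computable_comp hS (computable_nsnd computable_id).
by congr computable; apply/funext => v.
Qed.

(** Iterating a constant function [F x] times leaves the start [G x] if [F x] is 0 and yields the
    constant [H x] otherwise. *)
Lemma computable_ifz F G H : computable F -> computable G -> computable H ->
  computable (fun x => if F x is 0 then G x else H x).
Proof.
move=> hF hG hH.
rewrite (_ : (fun x => _) = fun x => iter (F x) (fun=> H x) (G x)).
  apply: (computable_iter (S := fun x _ => H x)) => //.
  exact: computable_comp hH (computable_nsnd computable_id).
by apply/funext => x; case: (F x).
Qed.

Definition decidable (P : nat -> bool) : Prop := computable (fun x => P x : nat).

Lemma computable_if P G H : decidable P -> computable G -> computable H ->
  computable (fun x => if P x then G x else H x).
Proof.
move=> hP hG hH; have := computable_ifz hP hH hG.
by congr computable; apply/funext => x; case: (P x).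
Qed.

Lemma decidable_if P P1 P2 : decidable P -> decidable P1 -> decidable P2 ->
  decidable (fun x => if P x then P1 x else P2 x).
Proof.
move=> hP h1 h2; have := computable_if hP h1 h2.
by congr computable; apply/funext => x; case: (P x).
Qed.

Lemma decidable_eq0 F : computable F -> decidable (fun x => F x == 0%N).
Proof.
move=> hF; have := computable_ifz hF (computable_const 1) (computable_const 0).
by congr computable; apply/funext => x; case: (F x).
Qed.

Lemma decidable_leq F G : computable F -> computable G ->
  decidable (fun x => F x <= G x)%N.
Proof. by move=> hF hG; apply: decidable_eq0; apply: computable_sub. Qed.

Lemma decidable_and P1 P2 : decidable P1 -> decidable P2 ->
  decidable (fun x => P1 x && P2 x).
Proof.
move=> h1 h2; have := computable_mul h1 h2.
by congr computable; apply/funext => x; case: (P1 x); case: (P2 x).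
Qed.

Lemma decidable_not P : decidable P -> decidable (fun x => ~~ P x).
Proof.
move=> h; have := decidable_eq0 h.
by congr decidable; apply/funext => x; case: (P x).
Qed.

Lemma decidable_eq F G : computable F -> computable G ->
  decidable (fun x => F x == G x).
Proof.
move=> hF hG; have := decidable_and (decidable_leq hF hG) (decidable_leq hG hF).
by congr decidable; apply/funext => x; rewrite -eqn_leq.
Qed.

Lemma decidable_all F P : computable F ->
  decidable (fun v => P (nsnd v) (nfst v)) ->
  decidable (fun x => all (P x) (iota 0 (F x))).
Proof.
move=> hF hP.
rewrite /decidable (_ : (fun x => _) =
  fun x => iteri (F x) (fun n r => r * P x n)%N 1%N); last first.
  apply/funext => x; elim: (F x) => // n IH.
  by rewrite -addn1 iotaD all_cat addn1 /= -IH andbT add0n mulnb.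
apply: (computable_iteri (S := fun x n r => r * P x n)%N) => //.
  exact: computable_const.
apply: computable_mul; first exact: computable_nfst (computable_nsnd computable_id).
have := computable_comp hP (computable_npair (computable_nfst computable_id)
  (computable_nsnd (computable_nsnd computable_id))).
by congr computable; apply/funext => x; rewrite !npairE.
Qed.

Lemma computable_pred F : computable F -> computable (fun n => (F n).-1).
Proof.
move=> h; have := computable_sub h (computable_const 1).
by congr computable; apply/funext => n; rewrite subn1.
Qed.

Lemma decidable_odd F : computable F -> decidable (fun x => odd (F x)).
Proof.
move=> hF; rewrite /decidable (_ : (fun x => _) = fun x => iter (F x) (subn 1) 0%N).
  apply: (computable_iter (S := fun=> subn 1)) => //; first exact: computable_const.
  exact: computable_sub (computable_const 1) (computable_nfst computable_id).
by apply/funext => x; elim: (F x) => //= n <-; case: (odd n).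
Qed.

(* The search need not terminate away from the values of [H]. *)
Lemma computable_search_rec H T out :
  decidable (fun v => T (nfst v) (nfst (nsnd v)) (nsnd (nsnd v))) ->
  computable out ->
  (forall k, exists w, T w k (H k)) ->
  (forall k w, T w k (H k) -> out w = H k.+1) ->
  computable H.
Proof.
move=> hT [o ho] ex outE; have [p hp] := computable2_npair.
have [t ht] := decidable_not hT.
(* Recursion on the list [[:: k]] runs its base code on the empty list, so a code for the constant
   [H 0] without arguments is required. *)
have [h0 hh0] : exists h0, eval u h0 [::] (H 0%N).
  have [c hc] := computable_const (H 0%N); exists (CComp c [:: CZero]).
  by apply: ev_comp (hc 0%N); evals; constructor.
pose t' := CComp t [:: CComp p [:: CProj 0; CComp p [:: CProj 1; CProj 2]]].
have ht' w k r : eval u t' [:: w; k; r] (~~ T w k r).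
  have := ht (npair w (npair k r)); rewrite !npairE; apply: ev_comp.
  evals; apply: ev_comp (hp _ _); evals; first by proj.
  by apply: ev_comp (hp _ _); evals; proj.
exists (CPrim h0 (CComp o [:: CMu t'])); elim => [|k IH]; first exact: ev_prim0.
(* [CMu] returns the least witness; by [outE] every witness has the same output. *)
apply: (ev_primS IH); case: (ex_minnP (ex k)) => w Tw wmin.
rewrite -(outE _ _ Tw); apply: ev_comp (ho w); evals; apply: ev_mu.
  by have := ht' w k (H k); rewrite Tw.
move=> m /ssrnat.ltP hm; exists 0%N; have := ht' m k (H k).
by have /negP/negPf -> : ~ T m k (H k) by [move=> /wmin; rewrite leqNgt hm].
Qed.

End Computable.

(* Matching on the syntax avoids the costly unification attempts of [apply]. *)
Ltac computable_rec := cbv zeta; lazymatch goal with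
  | |- computable _ (fun _ => ?k) => exact: computable_const
  | |- computable _ (fun x => x) => exact: computable_id
  | |- computable _ (fun x => npair (@?F x) (@?G x)) =>
      refine (computable_npair (F := F) (G := G) _ _); computable_rec
  | |- computable _ (fun x => nfst (@?F x)) =>
      refine (computable_nfst (F := F) _); computable_rec
  | |- computable _ (fun x => nsnd (@?F x)) =>
      refine (computable_nsnd (F := F) _); computable_rec
  | |- computable _ (fun x => S (@?F x)) =>
      refine (computable_succ (F := F) _); computable_rec
  | |- computable _ (fun x => (@?F x).-1) =>
      refine (computable_pred (F := F) _); computable_rec
  | |- computable _ (fun x => addn (@?F x) (@?G x)) =>
      refine (computable_add (F := F) (G := G) _ _); computable_rec
  | |- computable _ (fun x => subn (@?F x) (@?G x)) =>
      refine (computable_sub (F := F) (G := G) _ _); computable_rec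
  | |- computable _ (fun x => if _ then _ else _) =>
      apply: computable_if; computable_rec
  | |- decidable _ (fun x => @?P x && @?Q x) =>
      refine (decidable_and (P1 := P) (P2 := Q) _ _); computable_rec
  | |- decidable _ (fun x => if _ then _ else _) =>
      apply: decidable_if; computable_rec
  | |- decidable _ (fun x => odd (@?F x)) =>
      refine (decidable_odd (F := F) _); computable_rec
  | |- decidable _ (fun x => ~~ @?P x) =>
      refine (decidable_not (P := P) _); computable_rec
  | |- decidable _ (fun x => @?F x == @?G x) =>
      refine (decidable_eq (F := F) (G := G) _ _); computable_rec
  | |- decidable _ (fun x => leq (@?F x) (@?G x)) =>
      refine (decidable_leq (F := F) (G := G) _ _); computable_rec
  | _ => try assumption
  end.
(** * A universal machine *)

(* The generated scheme lacks induction hypotheses below the existential of [ev_mu]. *)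
Section EvalInd.
Variables (o : nat -> bool) (P : code -> list nat -> nat -> Prop)
  (Q : list code -> list nat -> list nat -> Prop).
Hypothesis Pzero : forall xs, P CZero xs 0.
Hypothesis Psucc : forall x xs, P CSucc (x :: xs) x.+1.
Hypothesis Pproj : forall i xs, (i < length xs)%coq_nat ->
  P (CProj i) xs (List.nth i xs 0%N).
Hypothesis Poracle : forall x xs, P COracle (x :: xs) (b2n (o x)).
Hypothesis Pcomp : forall f gs xs ys y, Q gs xs ys -> P f ys y ->
  P (CComp f gs) xs y.
Hypothesis Pprim0 : forall f g xs y, P f xs y -> P (CPrim f g) (0 :: xs) y.
Hypothesis PprimS : forall f g n xs r y, P (CPrim f g) (n :: xs) r ->
  P g (n :: r :: xs) y -> P (CPrim f g) (n.+1 :: xs) y.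
Hypothesis Pmu : forall f xs n, P f (n :: xs) 0 ->
  (forall m, (m < n)%coq_nat -> exists k, P f (m :: xs) k.+1) -> P (CMu f) xs n.
Hypothesis Qnil : forall xs, Q [::] xs [::].
Hypothesis Qcons : forall g gs xs y ys, P g xs y -> Q gs xs ys ->
  Q (g :: gs) xs (y :: ys).

Fixpoint eval_nested_ind c xs y (e : eval o c xs y) : P c xs y :=
  match e with
  | ev_zero xs => Pzero xs
  | ev_succ x xs => Psucc x xs
  | ev_proj i xs lt => Pproj lt
  | ev_oracle x xs => Poracle x xs
  | ev_comp f gs xs ys y e1 e2 => Pcomp (evals_nested_ind e1) (eval_nested_ind e2)
  | ev_prim0 f g xs y e1 => Pprim0 g (eval_nested_ind e1)
  | ev_primS f g n xs r y e1 e2 => PprimS (eval_nested_ind e1) (eval_nested_ind e2)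
  | ev_mu f xs n e1 lt => Pmu (eval_nested_ind e1) (fun m h =>
      match lt m h with ex_intro k e2 => ex_intro _ k (eval_nested_ind e2) end)
  end
with evals_nested_ind cs xs ys (e : evals o cs xs ys) : Q cs xs ys :=
  match e with
  | evs_nil xs => Qnil xs
  | evs_cons g gs xs y ys e1 e2 => Qcons (eval_nested_ind e1) (evals_nested_ind e2)
  end.
End EvalInd.

(* Configurations are [Ev c xs K] (run code [c] on [xs], then return to the stack [K])
   and [Ret v K]. The tags 7 and 8 encode lists of codes, evaluated pointwise;
   in a stack, tag 0 is the bottom. *)
Definition Ev c xs K := npair 0 (npair c (npair xs K)).
Definition Ret v K := npair 1 (npair v K).
Definition frame t a K := npair t (npair a K).

Section Machine.
Variable o : nat -> bool.

Definition ev_step t a xs K :=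
  if t == 0 then Ret 0 K
  else if t == 1 then Ret (nfst xs).+1 K
  else if t == 2 then
    if a == 0 then Ret (nfst xs) K else Ev (npair 2 a.-1) (nsnd xs) K
  else if t == 3 then Ret (b2n (o (nfst xs))) K
  else if t == 4 then Ev (nsnd a) xs (frame 1 (nfst a) K)
  else if t == 5 then
    if nfst xs == 0 then Ev (nfst a) (nsnd xs) K
    else Ev (npair 5 a) (npair (nfst xs).-1 (nsnd xs))
      (frame 2 (npair (nsnd a) (npair (nfst xs).-1 (nsnd xs))) K)
  else if t == 6 then Ev a (npair 0 xs) (frame 3 (npair a (npair 0 xs)) K)
  else if t == 7 then Ret 0 K
  else Ev (nfst a) xs (frame 4 (npair (nsnd a) xs) K).

(** Frame 1 holds the outer code of a composition, 2 the step code of a recursion with counter and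
    parameters, 3 a search with its current candidate, 4 the remaining codes of a list with their
    arguments, 5 a computed head awaiting its tail. At the bottom of the stack the machine loops,
    which makes [Ret v 0] a fixed point. *)
Definition ret_step v t a K :=
  if t == 1 then Ev a v K
  else if t == 2 then
    Ev (nfst a) (npair (nfst (nsnd a)) (npair v (nsnd (nsnd a)))) K
  else if t == 3 then
    if v == 0 then Ret (nfst (nsnd a)) K
    else Ev (nfst a) (npair (nfst (nsnd a)).+1 (nsnd (nsnd a)))
      (frame 3 (npair (nfst a) (npair (nfst (nsnd a)).+1 (nsnd (nsnd a)))) K)
  else if t == 4 then Ev (nfst a) (nsnd a) (frame 5 v K)
  else if t == 5 then Ret (npair a v) K
  else Ret v 0.

Definition step x :=
  let y := nsnd x in
  if nfst x == 0 then
    ev_step (nfst (nfst y)) (nsnd (nfst y)) (nfst (nsnd y)) (nsnd (nsnd y))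
  else
    ret_step (nfst y) (nfst (nsnd y)) (nfst (nsnd (nsnd y))) (nsnd (nsnd (nsnd y))).

Lemma step_Ev t a xs K : step (Ev (npair t a) xs K) = ev_step t a xs K.
Proof. by rewrite /step /Ev !npairE. Qed.

Lemma step_Ret v t a K : step (Ret v (frame t a K)) = ret_step v t a K.
Proof. by rewrite /step /Ret /frame !npairE. Qed.

Definition reach x y := exists n, iter n step x = y.

Lemma reach_refl x : reach x x.
Proof. by exists 0%N. Qed.

Lemma reach_trans x y z : reach x y -> reach y z -> reach x z.
Proof. by move=> [n <-] [m <-]; exists (m + n)%N; rewrite iterD. Qed.

Lemma reach_step x y : reach (step x) y -> reach x y.
Proof. by apply: reach_trans; exists 1%N. Qed.

Fixpoint code_nat (c : code) : nat :=
  match c with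
  | CZero => npair 0 0
  | CSucc => npair 1 0
  | CProj i => npair 2 i
  | COracle => npair 3 0
  | CComp f gs => npair 4 (npair (code_nat f)
      (foldr (fun g r => npair 8 (npair (code_nat g) r)) (npair 7 0) gs))
  | CPrim f g => npair 5 (npair (code_nat f) (code_nat g))
  | CMu f => npair 6 (code_nat f)
  end.

Definition codes_nat := foldr (fun g r => npair 8 (npair (code_nat g) r)) (npair 7 0).
Definition list_nat := foldr npair 0%N.

Ltac run := apply: reach_step; rewrite ?step_Ev ?step_Ret /ev_step /ret_step /= ?npairE.

(** The induction needs an arbitrary stack, because subcomputations run on top of pushed frames. *)
Lemma eval_reach c xs y : eval o c xs y -> forall K,
  reach (Ev (code_nat c) (list_nat xs) K) (Ret y K).
Proof.
apply: (eval_nested_ind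
  (P := fun c xs y => forall K, reach (Ev (code_nat c) (list_nat xs) K) (Ret y K))
  (Q := fun cs xs ys => forall K,
    reach (Ev (codes_nat cs) (list_nat xs) K) (Ret (list_nat ys) K))) => {c xs y} /=.
- by move=> xs K; run; apply: reach_refl.
- by move=> x xs K; run; apply: reach_refl.
- move=> i xs lt K; elim: i xs lt => [|i IH] [|x xs] /= lt; try lia.
    by run; apply: reach_refl.
  by run; apply: IH; lia.
- by move=> x xs K; run; apply: reach_refl.
- move=> f gs xs ys y IH1 IH2 K; run.
  by apply: reach_trans (IH1 _) _; run; apply: IH2.
- by move=> f g xs y IH K; run; apply: IH.
- move=> f g n xs r y IH1 IH2 K; run.
  by apply: reach_trans (IH1 _) _; run; apply: IH2.
- move=> f xs n IH lt K; run.
  (* The search rejects the candidates below [n] one after the other. *)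
  have start m : (m <= n)%N -> reach
      (Ev (code_nat f) (npair 0 (list_nat xs))
        (frame 3 (npair (code_nat f) (npair 0 (list_nat xs))) K))
      (Ev (code_nat f) (npair m (list_nat xs))
        (frame 3 (npair (code_nat f) (npair m (list_nat xs))) K)).
    elim: m => [|m IHm] le; first exact: reach_refl.
    apply: reach_trans (IHm (ltnW le)) _.
    have [k ek] := lt m (elimT ssrnat.ltP le).
    by apply: reach_trans (ek _) _; run; apply: reach_refl.
  apply: reach_trans (start n (leqnn n)) _.
  by apply: reach_trans (IH _) _; run; apply: reach_refl.
- by move=> xs K; run; apply: reach_refl.
- move=> g gs xs y ys IH1 IH2 K; run.
  apply: reach_trans (IH1 _) _; run.
  by apply: reach_trans (IH2 _) _; run; apply: reach_refl.
Qed.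

(* The result after [s] steps, shifted by one; 0 means not halted yet. *)
Definition run_for i m s :=
  let x := iter s step (Ev i (npair m 0) 0) in
  if (nfst x == 1) && (nsnd (nsnd x) == 0) then (nfst (nsnd x)).+1 else 0%N.

Lemma run_for_mono i m s s' : (s <= s')%N -> run_for i m s <> 0%N ->
  run_for i m s' = run_for i m s.
Proof.
move=> /subnK <-; rewrite /run_for iterD; set x := iter s _ _.
case: ifP => // /andP[/eqP x1 /eqP x0] _.
(* As [npair] is not onto, the test does not make [x] literally of the form [Ret v 0]; hence the
   invariant concerns three components only. *)
have fixed t : let y := iter t step x in
    [/\ nfst y = 1%N, nsnd (nsnd y) = 0%N & nfst (nsnd y) = nfst (nsnd x)].
  elim: t => [//|t] /=; set y := iter t _ _ => -[y1 y0 <-].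
  rewrite {1 2 3}/step y1 /= y0 /ret_step (_ : nfst 0 = 0%N) //= /Ret.
  by rewrite !npairE.
by have [-> -> ->] := fixed (s' - s)%N.
Qed.

Lemma run_for_complete (b : nat -> bool) : turing_le b o ->
  exists i, forall m, exists s, run_for i m s = (b2n (b m)).+1.
Proof.
move=> [c hc]; exists (code_nat c) => m.
have [s hs] := eval_reach (hc m) 0; exists s.
by move: hs; rewrite /run_for /list_nat /= => ->; rewrite /Ret !npairE.
Qed.

Variable u : nat -> bool.
Hypothesis o_u : turing_le o u.

Lemma computable_step : computable u step.
Proof.
rewrite /step /ev_step /ret_step /Ev /Ret /frame; computable_rec.
by apply: (computable_comp (F := fun n => b2n (o n)) o_u); computable_rec.
Qed.

Lemma computable_run_for I M S : computable u I -> computable u M ->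
  computable u S -> computable u (fun x => run_for (I x) (M x) (S x)).
Proof.
move=> hI hM hS.
have h : computable u (fun x => iter (S x) step (Ev (I x) (npair (M x) 0) 0)).
  apply: (computable_iter (S := fun=> step)) => //; first by rewrite /Ev; computable_rec.
  exact: computable_comp computable_step (computable_nfst (computable_id u)).
by rewrite /run_for; computable_rec.
Qed.

End Machine.

(** * Decoding *)

Section Decoding.
Variable c : nat -> bool.

Definition is_index i (y : nat -> bool) : Prop :=
  forall m, exists s, run_for c i m s = (b2n (y m)).+1.

Definition wrong_below q i (y : nat -> bool) : Prop :=
  exists2 m, (m < q)%N & forall s, run_for c i m s <> (b2n (y m)).+1.

Lemma wrong_below_le q q' i y : (q <= q')%N ->
  is_index i y \/ wrong_below q i y -> is_index i y \/ wrong_below q' i y.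
Proof.
by move=> le [|[m lt hm]]; [left|right; exists m => //; apply: leq_trans le].
Qed.

Lemma wrong_bound y p :
  exists q, forall i, (i <= p)%N -> is_index i y \/ wrong_below q i y.
Proof.
have one i : exists q, is_index i y \/ wrong_below q i y.
  have [h|/existsNP[m hm]] := pselect (is_index i y); first by exists 0%N; left.
  by exists m.+1; right; exists m => // s e; apply: hm; exists s.
elim: p => [|p [q hq]]; first by have [q hq] := one 0%N; exists q; case.
have [q' hq'] := one p.+1; exists (maxn q q') => i; rewrite leq_eqVlt.
move=> /orP[/eqP->|/hq h]; first exact: wrong_below_le (leq_maxr _ _) hq'.
exact: wrong_below_le (leq_maxl _ _) h.
Qed.

(** For an index [i] of [y], this is a decidable certificate that [z] leaves [y] exactly at [m]. *)
Definition diverges_at (z : nat -> bool) i m s : bool :=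
  all (fun k => run_for c i k s == (b2n (z k)).+1) (iota 0 m) &&
  ((run_for c i m s != 0%N) && (run_for c i m s != (b2n (z m)).+1)).

Lemma diverges_at_ex z y i d : is_index i y ->
  (forall m, (m < d)%N -> z m = y m) -> z d <> y d -> exists s, diverges_at z i d s.
Proof.
move=> iy zy zyd.
(* By monotonicity one step bound serves finitely many inputs. *)
have [s hs] : exists s, forall m, (m <= d)%N -> run_for c i m s = (b2n (y m)).+1.
  elim: d {zy zyd} => [|d [s hs]].
    by have [s hs] := iy 0%N; exists s; case.
  have [s' hs'] := iy d.+1; exists (maxn s s') => m; rewrite leq_eqVlt.
  case/orP => [/eqP->|/hs e].
    by rewrite -hs'; apply: run_for_mono; rewrite ?leq_maxr ?hs'.
  by rewrite -e; apply: run_for_mono; rewrite ?leq_maxl ?e.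
exists s; rewrite /diverges_at hs //=; apply/andP; split.
  by apply/allP => m; rewrite mem_iota => lt; rewrite zy // hs // ltnW.
by apply/eqP => -[]; move: zyd; case: (z d); case: (y d).
Qed.

(** A wrong index misses [y] at some place below [q], hence below both [d] and [m]; there a
    certificate would force it to agree with [z], which equals [y]. A correct index first disagrees
    with [z] at [d]. *)
Lemma diverges_at_uniq z y i d m s q :
  is_index i y \/ wrong_below q i y -> (q <= d)%N -> (q <= m)%N ->
  (forall m, (m < d)%N -> z m = y m) -> z d <> y d ->
  diverges_at z i m s -> m = d.
Proof.
move=> iy qd qm zy zyd /andP[/allP h /andP[/eqP h0 /eqP hm]].
have {}h k : (k < m)%N -> run_for c i k s = (b2n (z k)).+1.
  by move=> lt; apply/eqP/h; rewrite mem_iota.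
case: iy => [iy|[k kq hk]]; last first.
  by case: (hk s); rewrite h ?zy //; apply: leq_trans kq _.
have val k : run_for c i k s <> 0%N -> run_for c i k s = (b2n (y k)).+1.
  move=> k0; have [s' hs'] := iy k.
  rewrite -(run_for_mono (leq_maxl s s')) // -hs'; apply: run_for_mono.
    exact: leq_maxr.
  by rewrite hs'.
case: (ltngtP m d) => // lt; first by case: hm; rewrite val // zy.
have := val d; rewrite h // => /(_ _)[]// e.
by move: zyd e; case: (z d); case: (y d).
Qed.

Variable u : nat -> bool.
Hypothesis c_u : turing_le c u.

Lemma decidable_diverges_at z I M S : turing_le z u ->
  computable u I -> computable u M -> computable u S ->
  decidable u (fun x => diverges_at z (I x) (M x) (S x)).
Proof.
move=> zu hI hM hS.
have hz F : computable u F -> computable u (fun x => b2n (z (F x))).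
  exact: (computable_comp (F := fun n => b2n (z n))).
have hr := computable_run_for c_u.
rewrite /diverges_at; computable_rec; try exact: hr; last exact: hz.
apply: (decidable_all (P := fun x k => run_for c (I x) k (S x) == (b2n (z k)).+1)) => //.
have snd F : computable u F -> computable u (fun x => F (nsnd x)).
  by move=> hF; apply: computable_comp hF (computable_nsnd (computable_id u)).
have fst := computable_nfst (computable_id u).
computable_rec; last exact: hz.
by apply: hr => //; apply: snd.
Qed.

(* [n k false] and [n k true] are the places where the [k]-th pair of targets
   [y k] is left; their minimum bounds indices of the next targets, and their
   maximum tells the wrong indices below that bound apart. *)
Lemma decode_turing_le (x : nat -> bool) (z : bool -> bool -> nat -> bool)
    (y : nat -> bool -> nat -> bool) (n : nat -> bool -> nat) :
  let lo k := minn (n k false) (n k true) in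
  let hi k := maxn (n k false) (n k true) in
  (forall g j, turing_le (z g j) u) ->
  (forall k j, exists2 i, (i <= lo k)%N & is_index i (y k.+1 j)) ->
  (forall k j i, (i <= lo k)%N ->
    is_index i (y k.+1 j) \/ wrong_below (hi k) i (y k.+1 j)) ->
  (forall k j, (hi k <= n k.+1 j)%N) ->
  (forall k j m, (m < n k j)%N -> z (odd k) j m = y k j m) ->
  (forall k j, z (odd k) j (n k j) <> y k j (n k j)) ->
  (forall k, x k = (n k false < n k true)%N) ->
  turing_le x u.
Proof.
move=> lo hi zu idx wrong hin zy zyn xE.
pose H k := npair (n k false) (n k true).
pose test g j w r :=
  (* A witness packs an index, a departure place and a step bound; [r] carries the two previous
     departure places. *)
  let i := nfst w in let m := nfst (nsnd w) in
  [&& (i <= minn (nfst r) (nsnd r))%N, (maxn (nfst r) (nsnd r) <= m)%N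
    & diverges_at (z g j) i m (nsnd (nsnd w))].
(* The parity is split so that each test mentions one fixed real: the reductions of the four reals
   to [u] are given separately. *)
pose T w k r := if odd k then test false false (nfst w) r && test false true (nsnd w) r
  else test true false (nfst w) r && test true true (nsnd w) r.
pose out w := npair (nfst (nsnd (nfst w))) (nfst (nsnd (nsnd w))).
have TE w k r : T w k r =
    test (odd k.+1) false (nfst w) r && test (odd k.+1) true (nsnd w) r.
  by rewrite /T /=; case: (odd k).
suff hH : computable u H.
  suff : decidable u (fun k => nfst (H k) < nsnd (H k))%N.
    by congr computable; apply/funext => k; rewrite /H !npairE xE; case: leq.
  by computable_rec.
apply: (@computable_search_rec _ H T out).
- rewrite /T /test /minn /maxn.
  by computable_rec; apply: decidable_diverges_at => //; computable_rec.
- by rewrite /out; computable_rec.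
- move=> k.
  have ex j : exists w, test (odd k.+1) j w (H k).
    have [i ilo iy] := idx k j.
    have [s hs] := diverges_at_ex iy (zy k.+1 j) (zyn k.+1 j).
    exists (npair i (npair (n k.+1 j) s)).
    by rewrite /test /H !npairE hs hin ilo.
  have [[w0 h0] [w1 h1]] := (ex false, ex true).
  by exists (npair w0 w1); rewrite TE !npairE h0.
- move=> k w; rewrite TE => /andP[h0 h1].
  (* Whichever index the search accepts, the place it reports is the true one. *)
  have uniq j v : test (odd k.+1) j v (H k) -> nfst (nsnd v) = n k.+1 j.
    rewrite /test /H !npairE => /and3P[hi1 hi2]; apply: diverges_at_uniq.
    + exact: wrong hi1.
    + exact: hin.
    + exact: hi2.
    + exact: zy.
    + exact: zyn.
  by rewrite /out (uniq _ _ h0) (uniq _ _ h1).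
Qed.

End Decoding.

(** * Analytic sets *)

Definition agree T N (w w' : nat -> T) : Prop := forall k, (k < N)%N -> w k = w' k.

Lemma agree_le T M N (w w' : nat -> T) : (M <= N)%N -> agree N w w' -> agree M w w'.
Proof. by move=> le h k lt; apply: h; apply: leq_trans le. Qed.

(** Closedness in the product of Baire space and Cantor space, through basic neighbourhoods. *)
Definition closed_rel (C : (nat -> nat) -> cs -> Prop) : Prop :=
  forall w y,
    (forall N, exists w' y', [/\ agree N w w', agree N y y' & C w' y']) -> C w y.

Definition analytic (A : set cs) : Prop :=
  exists C, closed_rel C /\ forall y, A y <-> exists w, C w y.

Definition slice i (w : nat -> nat) k := w (npair i k).

Lemma agree_slice i N w w' :
  agree (npair i N) w w' -> agree N (slice i w) (slice i w').
Proof. by move=> h k lt; apply: h; rewrite /npair; nia. Qed.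

Lemma unslice (v : nat -> nat -> nat) : exists w, forall i, slice i w = v i.
Proof.
exists (fun m => v (nfst m) (nsnd m)) => i.
by apply/funext => k; rewrite /slice !npairE.
Qed.

(** The first entry of a witness selects the set and the tail is a witness for it; nearby points
    share the first entry. *)
Lemma analytic_bigcup (F : nat -> set cs) :
  (forall n, analytic (F n)) -> analytic (\bigcup_n F n).
Proof.
move=> /choice[C hC].
exists (fun w y => C (w 0%N) (fun k => w k.+1) y); split.
  move=> w y h; have [cl _] := hC (w 0%N); apply: cl => N.
  have [w' [y' [ww' yy' Cw']]] := h N.+1; exists (fun k => w' k.+1), y'.
  split=> [k lt||]; [exact: ww'|exact: agree_le yy'|by rewrite ww'].
move=> y; split=> [[n _ Fy]|[w Cw]].
  have [_ /(_ y)[/(_ Fy)[w Cw] _]] := hC n.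
  by exists (fun k => if k is k'.+1 then w k' else n).
by exists (w 0%N) => //; have [_ e] := hC (w 0%N); apply/e; exists (fun k => w k.+1).
Qed.

(** The slices of one sequence carry witnesses for all the sets. *)
Lemma analytic_bigcap (F : nat -> set cs) :
  (forall n, analytic (F n)) -> analytic (\bigcap_n F n).
Proof.
move=> /choice[C hC]; exists (fun w y => forall n, C n (slice n w) y); split.
  move=> w y h n; have [cl _] := hC n; apply: cl => N.
  have [w' [y' [ww' yy' Cw']]] := h (maxn N (npair n N)); exists (slice n w'), y'.
  split=> //; last exact: agree_le (leq_maxl _ _) yy'.
  by apply: agree_slice; apply: agree_le ww'; apply: leq_maxr.
move=> y; split=> [Fy|[w Cw] n _]; last first.
  by have [_ e] := hC n; apply/e; exists (slice n w).
have /choice[v hv] : forall n, exists w, C n w y.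
  by move=> n; have [_ e] := hC n; apply/e/Fy.
by have [w hw] := unslice v; exists w => n; rewrite hw.
Qed.

(** Otherwise points outside [U] would converge to [y]. *)
Lemma open_cylinder (U : set cs) (y : cs) : open U -> U y ->
  exists N, forall y' : cs, agree N y y' -> U y'.
Proof.
move=> oU Uy; apply: contrapT => /forallNP h.
have {h} /choice[g hg] : forall N, exists y' : cs, agree N y y' /\ ~ U y'.
  by move=> N; have /existsNP[y' /not_implyP] := h N; exists y'.
have gy : (g : nat -> cs) @ \oo --> y.
  apply/cvg_sup => i V [W] [[O] oO <-] Oy OV.
  apply: (filterS OV); rewrite nbhs_simpl; exists i.+1 => // n /= lt.
  by have [/(_ i lt) e _] := hg n; move: Oy; rewrite /= /proj e.
have [N _ /(_ N (leqnn N))] := gy U (open_nbhs_nbhs (conj oU Uy)).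
by have [_] := hg N.
Qed.

(** A witness starts with the length of a cylinder around [y] inside [U]. *)
Lemma analytic_open (U : set cs) : open U -> analytic U.
Proof.
move=> oU; exists (fun w y => forall y' : cs, agree (w 0%N) y y' -> U y'); split.
  move=> w y h; have [w' [y' [ww' yy' hU]]] := h (w 0%N).+1.
  move=> v yv; apply: hU; rewrite -ww' // => k lt.
  by rewrite -yv // yy' // ltnW.
move=> y; split=> [Uy|[w]]; last exact.
by have [N hN] := open_cylinder oU Uy; exists (fun=> N).
Qed.

Lemma analytic_setC_open (U : set cs) : open U -> analytic (~` U).
Proof.
move=> oU; exists (fun _ y => ~ U y); split; last first.
  by move=> y; split=> [|[]//]; exists (fun=> 0%N).
move=> w y h Uy; have [N hN] := open_cylinder oU Uy.
by have [w' [y' [_ yy' nUy']]] := h N; apply: nUy'; apply: hN.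
Qed.

(** The analytic sets with analytic complement form a sigma-algebra containing the open sets. *)
Lemma Borel_analytic (A : set cs) : Borel A -> analytic A /\ analytic (~` A).
Proof.
pose G : set (set cs) := [set A | analytic A /\ analytic (~` A)].
suff : <<s open >> `<=` G by apply.
apply: smallest_sub => [|U oU]; last first.
  by split; [apply: analytic_open|apply: analytic_setC_open].
split=> [|B [B1 B2]|F hF] /=.
- split; first exact/analytic_open/open0.
  exact/analytic_setC_open/open0.
- by rewrite setTD; split=> //; rewrite setCK.
- split; first by apply: analytic_bigcup => n; have [] := hF n.
  by rewrite setC_bigcup; apply: analytic_bigcap => n; have [] := hF n.
Qed.

(** A witness for [y] codes a preimage [a] by the parities of slice 0, a proof of [Q a] in slice 1,
    and in slice [n.+2] a proof that bit [n] of [f a] is [y n]; both answers are analytic conditions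
    on [a]. *)
Lemma analytic_image (P Q : set cs) (f : cs -> cs) : Q `<=` P -> Borel Q ->
  Borel_function_on P f -> analytic (f @` Q).
Proof.
move=> QP /Borel_analytic[[CQ [clQ hQ]] _] bf.
pose E n : set cs := P `&` f @^-1` [set y : cs | y n].
have bE n : analytic (E n) /\ analytic (~` E n).
  apply: Borel_analytic; apply: bf; apply: sub_sigma_algebra.
  have pn : continuous ((fun y => y n) : cs -> bool) by exact: proj_continuous.
  exact: (continuousP _).1 pn [set b : bool | b] (discrete_open _).
have /choice[CE hE] : forall n, exists C : bool -> _, forall b,
    closed_rel (C b) /\ forall y, (if b then E n else ~` E n) y <-> exists w, C b w y.
  move=> n; have [[C1 h1] [C0 h0]] := bE n.
  by exists (fun b => if b then C1 else C0); case.
pose dec w : cs := fun k => odd (slice 0 w k).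
exists (fun w y => CQ (slice 1 w) (dec w) /\
  forall n, CE n (y n) (slice n.+2 w) (dec w)); split.
  (* Each clause depends on [y] through the single bit [y n], which is constant near [y]. *)
  have cont C i n w y : closed_rel C ->
      (forall N, exists w' (y' : cs), [/\ agree N w w', agree N y y' &
         y n = y' n -> C (slice i w') (dec w')]) -> C (slice i w) (dec w).
    move=> cl h; apply: cl => N.
    have [w' [y' [ww' yy' Cw]]] := h (maxn n.+1 (maxn (npair 0 N) (npair i N))).
    exists (slice i w'), (dec w'); split.
    - by apply: agree_slice; apply: agree_le ww'; lia.
    - move=> k lt; rewrite /dec; congr odd; move: k lt.
      by apply: agree_slice; apply: agree_le ww'; lia.
    - by apply: Cw; apply: yy'; lia.
  move=> w y h; split.
    apply: (cont CQ 1%N 0%N w y clQ) => N.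
    by have [w' [y' [? ? [? _]]]] := h N; exists w', y'.
  move=> n; have [cl _] := hE n (y n); apply: (cont _ _ n w y cl) => N.
  have [w' [y' [? ? [_ Cw]]]] := h N; exists w', y'; split=> // ->.
  exact: Cw.
move=> y; split.
  move=> [a Qa <-]; have [v hv] := (hQ a).1 Qa.
  have /choice[g hg] : forall n, exists w, CE n (f a n) w a.
    move=> n; have [_ e] := hE n (f a n); apply/e.
    case b: (f a n); first by split; [exact: QP|exact: b].
    by case=> _ /=; rewrite b.
  have [w hw] := unslice (fun i => match i with
    0 => fun k => nat_of_bool (a k) | 1 => v | n.+2 => g n end).
  have dw : dec w = a by apply/funext => k; rewrite /dec hw oddb.
  by exists w; rewrite dw hw; split=> // n; rewrite hw.
move=> [w [hw1 hw2]]; have Qd : Q (dec w) by apply/hQ; exists (slice 1 w).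
exists (dec w) => //; apply/funext => n; have [_ /(_ (dec w))[_ e]] := hE n (y n).
have := e (ex_intro _ _ (hw2 n)); case: (y n); first by case.
by move=> h; apply/negbTE/negP => fn; apply: h; split=> //; apply: QP.
Qed.

Lemma agree_mkseq T (x0 : T) N (w w' : nat -> T) :
  mkseq w N = mkseq w' N -> agree N w w'.
Proof. by move=> e k lt; rewrite -(nth_mkseq x0 w lt) e nth_mkseq. Qed.

(* [K] consists of the points of a closed set projecting onto [A] all of whose
   neighbourhoods have an uncountable projection. *)
Lemma analytic_perfect_kernel (A : set cs) : analytic A -> ~ countable A ->
  exists K : set ((nat -> nat) * cs), [/\ K !=set0,
    forall p N, K p -> exists p', [/\ K p', agree N p.1 p'.1, agree N p.2 p'.2
      & p'.2 <> p.2]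
  & forall v : nat -> (nat -> nat) * cs, (forall k, K (v k)) ->
      (forall k, agree k (v k).1 (v k.+1).1 /\ agree k (v k).2 (v k.+1).2) ->
      A (fun m => (v m.+1).2 m)].
Proof.
move=> [C [cl hA]] Aunc.
pose D (s : seq nat * seq bool) : set cs := [set y | exists w,
  [/\ C w y, mkseq w (size s.1) = s.1 & mkseq y (size s.2) = s.2]].
pose at_ N (p : (nat -> nat) * cs) := (mkseq p.1 N, mkseq p.2 N).
have DatE N w y : C w y -> D (at_ N (w, y)) y.
  by move=> Cw; exists w; rewrite /= !size_mkseq.
pose K : set ((nat -> nat) * cs) := [set p | C p.1 p.2 /\
  forall N, ~ countable (D (at_ N p))].
(* As in the Cantor-Bendixson theorem, there are countably many neighbourhoods [t], so those with
   countable projection cover only a countable set; a point over any other [y'] lies in [K]. *)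
have big s y : ~ countable (D s) ->
    exists w y', [/\ K (w, y'), D s y', y' <> y & mkseq w (size s.1) = s.1].
  move=> Ds; pose bad := \bigcup_(t in [set t | countable (D t)]) D t.
  have cbad : countable bad by apply: bigcup_countable => //; apply: countableP.
  have [y' [Dy' nby y'y]] : exists y', [/\ D s y', ~ bad y' & y' <> y].
    apply: contrapT => h; apply: Ds.
    apply: (@sub_countable _ _ _ ([set y] `|` bad)); last first.
      by rewrite -bigcup2E; apply: bigcup_countable => //; case=> [|[|i]] //= _;
        apply: countable1.
    apply: subset_card_le => y' Dy'.
    have [->|/eqP ne] := eqVneq y' y; first by left.
    by right; apply: contrapT => nb; apply: h; exists y'.
  have [w [Cw sw sy]] := Dy'; exists w, y'; split=> //.
  split=> //= N cN; apply: nby; exists (at_ N (w, y')) => //.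
  exact: DatE.
exists K; split.
- have [|w [y [Ky _ _ _]]] := @big ([::], [::]) (fun=> true).
    move=> h; apply: Aunc; apply: sub_countable h.
    by apply: subset_card_le => y /hA[w Cw]; exists w.
  by exists (w, y).
- move=> [w y] N [_ /(_ N) unc].
  have [w' [y' [Kw' [_ [_ _ sy]] ne sw]]] := big _ y unc.
  exists (w', y'); split=> //=; move: sw sy; rewrite /= !size_mkseq => sw sy.
    exact: agree_mkseq 0%N _ _ _ (esym sw).
  exact: agree_mkseq true _ _ _ (esym sy).
(* Place [m] is settled from [v m.+1] on, and closedness puts the limit into [C]. *)
- move=> v Kv hv; apply/hA; exists (fun m => (v m.+1).1 m).
  have stab k k' : (k <= k')%N ->
      agree k (v k).1 (v k').1 /\ agree k (v k).2 (v k').2.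
    move=> /subnK <-; elim: (k' - k)%N => [|n [IH1 IH2]] //.
    have [h1 h2] := hv (n + k)%N; rewrite addSn.
    by split=> m lt; [rewrite IH1 // h1|rewrite IH2 // h2] => //; lia.
  apply: cl => N; exists (v N).1, (v N).2.
  split; last by have [] := Kv N.
    by move=> k lt; have [-> //] := stab k.+1 N lt.
  by move=> k lt; have [_ -> //] := stab k.+1 N lt.
Qed.


(** * Coding *)

Lemma coding_set (A : set cs) : analytic A -> ~ countable A ->
  exists B : set cs, [/\ countable B, B `<=` A &
    forall (c x : cs), (forall b, B b -> turing_le b c) ->
    exists z : bool -> bool -> cs, (forall g j, A (z g j)) /\
      forall u, turing_le c u -> (forall g j, turing_le (z g j) u) -> turing_le x u].
Proof.
move=> Aan Aunc; have [K [[p0 Kp0] Kext Klim]] := analytic_perfect_kernel Aan Aunc.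
have KA p : K p -> A p.2 by move=> Kp; apply: (Klim (fun=> p)).
(* [e] moves a kernel point [p] to another one agreeing with it below [N], and returns with it the
   first place where the second coordinates differ. *)
have /choice[e he] : forall pN : (nat -> nat) * cs * nat, exists q : (nat -> nat) * cs * nat,
    K pN.1 -> [/\ K q.1, (pN.2 <= q.2)%N, agree pN.2 pN.1.1 q.1.1,
      agree q.2 pN.1.2 q.1.2 & q.1.2 q.2 <> pN.1.2 q.2].
  move=> [p N]; have [Kp|nK] := pselect (K p); last by exists (p, N) => /nK.
  have [p' [Kp' a1 a2 ne]] := Kext p N Kp.
  have ex : exists d, p'.2 d != p.2 d.
    apply: contrapT => /forallNP h; apply: ne; apply/funext => k.
    exact/eqP/negPn/negP/h.
  case: (ex_minnP ex) => d hd dmin; exists (p', d) => _; split=> //=.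
  - by rewrite leqNgt; apply/negP => lt; move: hd; rewrite a2 ?eqxx.
  - move=> k lt; apply/eqP; rewrite eq_sym; apply: contraLR lt => /dmin.
    by rewrite -leqNgt.
  - exact/eqP.
(* Nodes are labelled by the moves made so far, latest first; [d l N] is the place where
   [b (N :: l)] leaves [b l]. *)
pose node : seq nat -> (nat -> nat) * cs := foldr (fun N p => (e (p, N)).1) p0.
have Knode l : K (node l) by elim: l => //= N l IH; have [] := he (node l, N) IH.
pose b l : cs := (node l).2.
pose d l N := (e (node l, N)).2.
have dge l N : (N <= d l N)%N by have [] := he (node l, N) (Knode l).
have bd l N : agree (d l N) (b l) (b (N :: l)).
  by have [] := he (node l, N) (Knode l).
have bdne l N : b (N :: l) (d l N) <> b l (d l N).
  by have [] := he (node l, N) (Knode l).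
exists (range b); split.
- by apply: card_le_trans (card_image_le _ _) _; apply: countableP.
- by move=> _ [l _ <-]; apply: KA.
move=> c x hc.
have idx l : exists i, is_index c i (b l) by apply: run_for_complete; apply: hc; exists l.
pose lo (n : bool -> nat) := minn (n false) (n true).
pose hi (n : bool -> nat) := maxn (n false) (n true).
(* One stage: [R] is the history of the pair about to move, [S] that of the other pair, and [L] a
   lower bound for the moves. *)
have /choice[NN hNN] : forall a : nat * ((bool -> seq nat) * (bool -> seq nat) * nat),
    exists N : bool -> nat,
    let R := a.2.1.1 in let S := a.2.1.2 in let n j := d (R j) (N j) in
    [/\ forall j, (a.2.2 < N j)%N,
      forall j, exists2 i, (i <= lo n)%N & is_index c i (b (S j)),
      forall j i, (i <= lo n)%N ->
        is_index c i (b (S j)) \/ wrong_below c (hi n) i (b (S j))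
    & x a.1 = (n false < n true)%N].
  move=> [k [[R S] L]] /=.
  have /choice[i hi_] : forall j, exists i, is_index c i (b (S j)) by move=> j; apply: idx.
  (* Member [j0] departs first, which codes [x k]. Its place [n0] is at least [N0], hence above
     indices of both targets of the other pair. *)
  pose j0 := ~~ x k; pose N0 := (L.+1 + i false + i true)%N.
  pose n0 := d (R j0) N0.
  have /choice[q hq] := fun j => wrong_bound c (b (S j)) n0.
  (* The second departure comes after [n0] and after an error of each wrong index up to [n0]. *)
  pose N1 := (L.+1 + n0.+1 + q false + q true)%N; pose n1 := d (R (~~ j0)) N1.
  have [n0N n1N] : (N0 <= n0)%N /\ (N1 <= n1)%N by split; apply: dge.
  have lt01 : (n0 < n1)%N by apply: leq_trans n1N; rewrite /N1; lia.
  pose N j := if j == j0 then N0 else N1; exists N.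
  set n := fun j => d (R j) (N j).
  have nE : n j0 = n0 /\ n (~~ j0) = n1.
    by rewrite /n /N eqxx /n0 /n1; split=> //; case: (j0).
  have [loE hiE] : lo n = n0 /\ hi n = n1.
    by rewrite /lo /hi; case: nE; case: (j0) => /= -> ->; lia.
  rewrite loE hiE; split.
  - by move=> j; rewrite /N; case: ifP => _; rewrite /N0 /N1; lia.
  - by move=> j; exists (i j) => //; apply: leq_trans n0N; rewrite /N0; case: j; lia.
  - move=> j m /(hq j); apply: wrong_below_le; apply: leq_trans n1N.
    by rewrite /N1; case: j; lia.
  - rewrite -/(n false) -/(n true).
    by move: nE; rewrite {1 2}/j0; case: (x k) => /= -[-> ->]; lia.
(* The state swaps the two histories at each stage, so the pairs alternate; its last component is
   the larger of the latest departure places. *)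
pose st := fix st k := if k is k'.+1 then
    let s := st k' in let N := NN (k', s) in
    (s.1.2, fun j => N j :: s.1.1 j, hi (fun j => d (s.1.1 j) (N j)))
  else ((fun=> [::], fun=> [::]), 0%N).
pose R k := (st k).1.1; pose N k := NN (k, st k).
pose n k j := d (R k j) (N k j).
have RS k j : R k.+2 j = N k j :: R k j by [].
have hN k : [/\ forall j, ((st k).2 < N k j)%N,
    forall j, exists2 i, (i <= lo (n k))%N & is_index c i (b (R k.+1 j)),
    forall j i, (i <= lo (n k))%N ->
      is_index c i (b (R k.+1 j)) \/ wrong_below c (hi (n k)) i (b (R k.+1 j))
  & x k = (n k false < n k true)%N] := hNN (k, st k).
have hiN k j : (hi (n k) < N k.+1 j)%N by have [/(_ j)] := hN k.+1.
have nN k j j' : (n k j < N k.+1 j')%N.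
  by apply: leq_ltn_trans (hiN k j'); rewrite /hi; case: j; lia.
have Nn k j : (N k j <= n k j)%N by apply: dge.
have kN k j : (k <= N k j)%N.
  by elim: k => // k IH; apply: leq_ltn_trans IH _; apply: leq_ltn_trans (Nn k j) _.
(* The history of member [j] of pair [g] after [i] moves; this pair moves at the stages of parity
   [g]. *)
pose v (g j : bool) i := R (g + i.*2) j.
have vS (g j : bool) i : v g j i.+1 = N (g + i.*2) j :: v g j i.
  by rewrite /v doubleS !addnS.
exists (fun g j m => b (v g j m.+1) m); split.
  move=> g j; apply: (Klim (fun i => node (v g j i))) => // i; rewrite vS.
  have le : (i <= N (g + i.*2) j)%N by apply: leq_trans (kN _ _); lia.
  have [_ leN a1 a2 _] := he (node (v g j i), N (g + i.*2) j) (Knode _).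
  split; first exact: agree_le le a1.
  by apply: agree_le (agree_le _ a2); [exact: le|exact: leN].
(* Later departures occur at or beyond [N (g + i.*2) j], so bits below it are final. *)
have stab (g j : bool) m i i' : (i <= i')%N -> (m < N (g + i.*2) j)%N ->
    b (v g j i') m = b (v g j i) m.
  move=> /subnK <- lt; elim: (i' - i)%N => [|t IH] //.
  rewrite addSn vS -bd //; apply: leq_trans (dge _ _); apply: leq_trans lt _.
  have mono k k' : (k <= k')%N -> (N k j <= N k' j)%N.
    move=> /subnK <-; elim: (k' - k)%N => [|s IHs] //; rewrite addSn.
    by apply: leq_trans IHs _; apply: ltnW; apply: leq_ltn_trans (Nn _ _) _.
  by apply: mono; lia.
(* The target chosen at stage [k] is itself left only after place [n k j], so the limit agrees with
   it up to and including that place. *)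
have zE k j m : (m <= n k j)%N -> b (v (odd k) j m.+1) m = b (R k.+2 j) m.
  move=> le; have kE : (odd k + k./2.*2)%N = k by apply: odd_double_half.
  have -> : R k.+2 j = v (odd k) j (k./2).+1 by rewrite /v doubleS !addnS kE.
  rewrite -(stab _ _ _ _ _ (leq_maxl m.+1 (k./2).+1)); last first.
    by apply: leq_trans (kN _ _); lia.
  apply: stab; first exact: leq_maxr.
  rewrite doubleS !addnS kE; apply: leq_ltn_trans le _.
  apply: ltn_trans (nN k j j) _.
  exact: leq_ltn_trans (Nn k.+1 j) (nN k.+1 j j).
move=> u cu zu.
apply: (decode_turing_le cu (y := fun k j => b (R k j)) (n := n) zu).
- by move=> k j; have [_ /(_ j)] := hN k.
- by move=> k j; have [_ _ /(_ j)] := hN k.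
- by move=> k j; apply: leq_trans (ltnW (hiN k j)) (Nn _ _).
- by move=> k j m lt; rewrite zE ?(ltnW lt) // RS -bd.
- by move=> k j; rewrite zE // RS; apply: bdne.
- by move=> k; have [] := hN k.
Qed.

(** * Transfer of directedness along the embedding *)

Lemma turing_le_refl a : turing_le a a.
Proof. by exists COracle => n; constructor. Qed.

Theorem theorem3p5 (P : set cs) (le : set (cs * cs)) (Q : set cs) (x : cs) :
  Borel_partial_order P le ->
  locally_countable P le ->
  (P #= [set: cs])%card ->
  Q `<=` P -> Borel Q -> ~ countable Q -> countably_directed le Q ->
  P x -> (forall q, Q q -> ~ le (x, q)) ->
  ~ exists f : cs -> cs, Borel_embedding_into_Turing P le f.
Proof.
move=> [_ [_ [_ [_ [anti _]]]]] _ _ QP bQ Qunc dir Px xQ [f [bf emb]].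
have finj : {in Q &, injective f}.
  move=> a b /set_mem/QP Pa /set_mem/QP Pb fab.
  by apply: anti => //; apply/emb; rewrite // fab; apply: turing_le_refl.
(* Pull [B] back along [f], bound the preimages in [Q], and map the bound forward. *)
have bound (B : set cs) : countable B -> B `<=` f @` Q ->
    exists2 u, Q u & forall b, B b -> turing_le b (f u).
  move=> cB BQ.
  have /choice[g hg] : forall b, exists a, B b -> Q a /\ f a = b.
    move=> b; have [/BQ[a Qa <-]|nB] := pselect (B b); last by exists b => /nB.
    by exists a.
  have [||u [Qu hu]] := dir (g @` B).
  - by move=> _ [b Bb <-]; have [] := hg b Bb.
  - exact: card_le_trans (card_image_le _ _) cB.
  - exists u => // b Bb; have [Qg <-] := hg b Bb.
    by apply/emb; [exact: QP|exact: QP|apply: hu; exists b].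
have Aunc : ~ countable (f @` Q).
  by rewrite (eq_countable (inj_card_eq finj)).
have [B [cB BQ code]] := coding_set (analytic_image QP bQ bf) Aunc.
have [c Qc hc] := bound B cB BQ.
have [z [zQ hz]] := code (f c) (f x) hc.
(* One element of [Q] whose image computes the four reals and, as [None], also [f c]. *)
have [||u Qu hu] := bound
    (range (fun o => if o is Some (g, j) then z g j else f c)).
- by apply: card_le_trans (card_image_le _ _) _; apply: countableP.
- by move=> _ [[[g j]|] _ <-] //; exists c.
apply: (xQ u Qu); apply/emb => //; first exact: QP.
by apply: hz => [|g j]; apply: hu; [exists None|exists (Some (g, j))].
Qed.
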